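(* Let $X$ and $Y$ be real-valued random variables on a probability space having finite moments of all orders. Then, as identities of formal power series: (1) If $X$ and $Y$ are independent, then $M_{X+Y}=M_X\boxplus^{-1}M_Y$. (2) $\displaystyle C^{-1}[M_X](\mathrm{i}z)=z\frac{d}{dz}C_X^\ast(z)$. (3) $n\,r_n(X)=\mathrm{i}^n\,\kappa_n^{-1}(M_X)$ for all $n\in\mathbb{Z}_{\ge1}$.
   Context: $\mathrm{i}$ is the imaginary unit. For a random variable $X$ with all moments finite, $M_X(z)=\sum_{k=0}^\infty\mathbb{E}[X^k]z^k$ and $\Psi_X(z)=\sum_{k=0}^\infty\frac{\mathbb{E}[X^k]}{k!}z^k$ (formal power series). The classical cumulant transform is $C_X^\ast(z)=\log(\Psi_X(\mathrm{i}z))$ (formal logarithm), and the numbers $r_n(X)$ (complex in general) are defined by $C_X^\ast(z)=\sum_{n=1}^\infty r_n(X)z^n$. The convolution $\boxplus^{-1}$ is the case $t=-1$ of the $t$-deformed convolution: for $A=\sum a_kz^k$ and $B=\sum b_kz^k$ in $\mathbb{R}\llbracket z\rrbracket$, $(A\boxplus^tB)(z)=\sum_{k=0}^\infty\sum_{i+j=k}\frac{(t)_{\underline{k}}}{(t)_{\underline{i}}(t)_{\underline{j}}}a_ib_jz^k$ with $(t)_{\underline{k}}=t(t-1)\cdots(t-k+1)$, so $(A\boxplus^{-1}B)(z)=\sum_{k=0}^\infty\sum_{i+j=k}\binom{k}{i}a_ib_jz^k$. For $A=1+\sum_{k\ge1}a_kz^k$, the $t$-deformed cumulants $\kappa_n^t(A)$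 and cumulant transform $C^t[A]$ are $C^t[A](z)=\sum_{n=1}^\infty\kappa_n^t(A)z^n=-\frac{z}{t}\frac{d}{dz}\log\left(1+\sum_{k=1}^\infty\frac{t^k}{(t)_{\underline{k}}}a_kz^k\right)$; here $t=-1$. The expression $C^{-1}[M_X](\mathrm{i}z)$ denotes the substitution $z\mapsto\mathrm{i}z$ in this series, over $\mathbb{C}$. *)

(* Defs.v *)
From HB Require Import structures.
From mathcomp Require Export all_boot all_order all_algebra.
From mathcomp Require Export complex.
From mathcomp Require Export all_classical all_reals all_analysis.

Set Implicit Arguments.
Unset Strict Implicit.
Unset Printing Implicit Defensive.

Export Order.TTheory GRing.Theory Num.Theory.
Export numFieldNormedType.Exports.

Local Open Scope classical_set_scope.
Local Open Scope ring_scope.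

(* A formal power series is its sequence of coefficients: [f n] is the
   coefficient of z^n. *)
Definition fps (K : Type) := nat -> K.

Section FormalPowerSeries.
Variable K : fieldType.
Implicit Types (f g : fps K) (c t : K).

Definition fps1 : fps K := fun n => (n == 0%N)%:R.

Definition fpsX : fps K := fun n => (n == 1%N)%:R.

Definition fps_sub f g : fps K := fun n => f n - g n.

Definition fps_scale c f : fps K := fun n => c * f n.

Definition fps_mul f g : fps K := fun n => \sum_(i < n.+1) f i * g (n - i)%N.

Definition fps_pow f m : fps K := iter m (fps_mul f) fps1.

Definition fps_deriv f : fps K := fun n => n.+1%:R * f n.+1.

(* The substitution z |-> c z. *)
Definition fps_dilate c f : fps K := fun n => c ^+ n * f n.

(* log f = \sum_(m >= 1) (-1)^(m-1) / m * (f - 1)^m, for f with constant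
   coefficient 1: then (f - 1)^m has no term of degree < m, so only
   1 <= m <= n contribute to the coefficient of z^n. *)
Definition fps_log f : fps K := fun n =>
  \sum_(1 <= m < n.+1) (-1) ^+ m.-1 / m%:R * fps_pow (fps_sub f fps1) m n.

Definition falling t k : K := \prod_(i < k) (t - i%:R).

(* The t-deformed operations are meant for t such that no [falling t k] is 0,
   that is, t not a natural number. *)
Definition tconv t f g : fps K := fun k =>
  \sum_(i < k.+1)
    falling t k / (falling t i * falling t (k - i)) * (f i * g (k - i)%N).

(* For f with constant coefficient 1. *)
Definition tcumulant_transform t f : fps K :=
  fps_scale (- t^-1) (fps_mul fpsX
    (fps_deriv (fps_log (fun k => t ^+ k / falling t k * f k)))).

Definition tcumulant t f (n : nat) : K := tcumulant_transform t f n.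

End FormalPowerSeries.

Definition fps_toC (R : realType) (f : fps R) : fps R[i] :=
  fun n => real_complex R (f n).

Section Moments.
Context {d : measure_display} {T : measurableType d} {R : realType}.
Variable P : probability T R.

Definition finite_moments (X : T -> R) : Prop :=
  forall k : nat, P.-integrable setT (EFin \o (fun w => X w ^+ k)).

Definition independent_RV (X Y : T -> R) : Prop :=
  forall A B : set R, measurable A -> measurable B ->
    P (X @^-1` A `&` Y @^-1` B) = (P (X @^-1` A) * P (Y @^-1` B))%E.

Definition moment (X : T -> R) (k : nat) : R :=
  fine 'E_P[fun w => X w ^+ k].

Definition moment_series (X : T -> R) : fps R := fun k => moment X k.

Definition exp_moment_series (X : T -> R) : fps R :=
  fun k => moment X k / k`!%:R.

Definition cumulant_transform (X : T -> R) : fps R[i] :=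
  fps_log (fps_dilate 'i%C (fps_toC (exp_moment_series X))).

Definition cumulant (X : T -> R) (n : nat) : R[i] := cumulant_transform X n.

End Moments.

(* Main.v *)
From HB Require Import structures.
Require Import Defs.
From mathcomp Require Import measurable_realfun.
From mathcomp Require Import ring.
Local Open Scope ring_scope.

(** At [t = -1] one has [(t)_k = (-1) ^ k * k!]. The weights of [tconv (-1)] are
    therefore binomial coefficients ([tconvN1]), and the series inside the
    logarithm of [tcumulant_transform (-1)] is the exponential generating
    series, the prefactor [- 1 / t] being 1 ([tcumulant_transformN1]).

    The first claim is thus the binomial formula for [E[(X + Y) ^ k]], where
    the mixed moments factor by independence. The factorization is Fubini's
    theorem: independence makes the law of the pair [(X, Y)] the product of the
    two laws ([independent_joint_law]). Nothing but the moments of [X] and [Y]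
    separately is assumed finite, so the integrability of [X ^ i * Y ^ j] has to
    come first, from Tonelli's theorem ([ge0_independent_integralM],
    [independent_integrableM]).

    For the other two claims, both sides are [z d/dz] applied to the logarithm
    of the exponential moment series. The formal logarithm commutes with the
    substitution [z |-> 'i z] ([fps_log_dilate]) and with the embedding of the
    reals in the complex numbers ([fps_log_map]), so the coefficients of [z ^ n]
    agree; the third claim is this equality of coefficients. *)

Section FormalSeries.
Variable K : fieldType.
Implicit Types f g : fps K.

Lemma fps_mulX_deriv f n : fps_mul (@fpsX K) (fps_deriv f) n = n%:R * f n.
Proof.
rewrite /fps_mul /fpsX /fps_deriv; case: n => [|n].
  by rewrite big_ord1 /= !mul0r.
rewrite !big_ord_recl big1 => [|i _]; last by rewrite /= mul0r.
by rewrite /= mul0r mul1r add0r addr0 subn1.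
Qed.

Lemma fps_powS f m : fps_pow f m.+1 = fps_mul f (fps_pow f m).
Proof. by []. Qed.

Lemma fps_pow_dilate c f m n :
  fps_pow (fps_dilate c f) m n = c ^+ n * fps_pow f m n.
Proof.
elim: m n => [|m IHm] n.
  by rewrite /fps_pow /= /fps1; case: n => [|n] /=; rewrite ?expr0 ?mulr0 ?mul1r.
rewrite !fps_powS /fps_mul mulr_sumr; apply: eq_bigr => -[i /= le_in] _.
by rewrite IHm /fps_dilate mulrACA -exprD subnKC.
Qed.

(** The constant term is fixed by [z |-> c z], so that subtracting 1 and
    taking powers, hence the logarithm, commute with this substitution. *)
Lemma fps_log_dilate c f : fps_log (fps_dilate c f) = fps_dilate c (fps_log f).
Proof.
have sub1 :
    fps_sub (fps_dilate c f) (@fps1 K) = fps_dilate c (fps_sub f (@fps1 K)).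
  apply: funext => -[|n]; rewrite /fps_sub /fps_dilate /fps1 /=.
    by rewrite expr0 !mul1r.
  by rewrite !subr0.
apply: funext => n; rewrite /fps_log {2}/fps_dilate mulr_sumr.
by apply: eq_bigr => m _; rewrite sub1 fps_pow_dilate mulrCA.
Qed.

Lemma fallingN1 k : falling (-1) k = (-1) ^+ k * k`!%:R :> K.
Proof.
rewrite /falling; elim: k => [|k IHk]; first by rewrite big_ord0 mul1r.
by rewrite big_ord_recr /= IHk factS exprS natrM -natr1; ring.
Qed.

(** At [t = -1] the weight [t ^ k / (t)_k] is [1 / k!]: the deformed transform
    takes the logarithm of the exponential generating series. *)
Lemma tcumulant_transformN1 f n :
  tcumulant_transform (-1) f n =
    n%:R * fps_log (fun k => f k / k`!%:R) n.
Proof.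
rewrite /tcumulant_transform /fps_scale invrN1 opprK mul1r fps_mulX_deriv.
congr (_ * fps_log _ n); apply: funext => k.
by rewrite fallingN1 invfM mulrA mulfV ?signr_eq0// mul1r mulrC.
Qed.

End FormalSeries.

Section Morphism.
Variables (K L : fieldType) (phi : {rmorphism K -> L}).

Lemma fps_pow_map (f : fps K) m n :
  fps_pow (phi \o f) m n = phi (fps_pow f m n).
Proof.
elim: m n => [|m IHm] n; first by rewrite /fps_pow /= /fps1 rmorph_nat.
rewrite !fps_powS /fps_mul rmorph_sum; apply: eq_bigr => i _.
by rewrite rmorphM -IHm.
Qed.

Lemma fps_log_map (f : fps K) : fps_log (phi \o f) = phi \o fps_log f.
Proof.
have sub1 : fps_sub (phi \o f) (@fps1 L) = phi \o fps_sub f (@fps1 K).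
  by apply: funext => n; rewrite /fps_sub /fps1 /= rmorphB rmorph_nat.
apply: funext => n; rewrite /fps_log /= rmorph_sum; apply: eq_bigr => m _.
by rewrite sub1 fps_pow_map !rmorphM fmorphV rmorph_nat rmorphXn rmorphN1.
Qed.

End Morphism.

(** At [t = -1] the signs in the three factorials cancel, as
    [i + (k - i) = k], and what is left is a binomial coefficient; hence
    [tconv (-1)] is the binomial convolution. *)
Lemma tconvN1 (K : numFieldType) (f g : fps K) k :
  tconv (-1) f g k = \sum_(i < k.+1) 'C(k, i)%:R * (f i * g (k - i)%N).
Proof.
apply: eq_bigr => -[i /=]; rewrite ltnS => le_ik _; congr (_ * _).
rewrite !fallingN1 mulrACA -exprD subnKC// -mulf_div divff ?signr_eq0// mul1r.
by rewrite -(bin_fact le_ik) !natrM mulfK// mulf_neq0// pnatr_eq0 -lt0n fact_gt0.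
Qed.

Section Independence.
Context {d : measure_display} {T : measurableType d} {R : realType}.
Context {P : probability T R}.
Variables X Y : {RV P >-> R}.

Definition RV_pair : T -> R * R := fun w => (X w, Y w).

Let measurable_RV_pair : measurable_fun setT RV_pair.
Proof. exact: measurable_fun_pair. Qed.

HB.instance Definition _ :=
  isMeasurableFun.Build _ _ _ _ RV_pair measurable_RV_pair.

Hypothesis indXY : independent_RV P X Y.

Local Open Scope ereal_scope.

(** Independence says that the two measures agree on measurable rectangles,
    which is enough to determine a product of sigma-finite measures. *)
Lemma independent_joint_law (h : R * R -> \bar R) :
  \int[distribution P RV_pair]_z h z =
  \int[distribution P X \x distribution P Y]_z h z.
Proof.
apply: eq_measure_integral => A mA _; apply/esym.
by apply: product_measure_unique => // B C mB mC; exact: indXY.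
Qed.

(** Tonelli for the product of the two laws; it assumes no finiteness, and so
    serves to prove integrability. *)
Lemma ge0_independent_integralM (f g : R -> \bar R) :
  measurable_fun setT f -> measurable_fun setT g ->
  (forall x, 0 <= f x) -> (forall y, 0 <= g y) ->
  \int[P]_w (f (X w) * g (Y w)) =
  (\int[P]_w f (X w)) * (\int[P]_w g (Y w)).
Proof.
move=> mf mg f0 g0; pose h z := f z.1 * g z.2.
have mh : measurable_fun setT h.
  by apply: emeasurable_funM; apply: measurableT_comp.
have h0 z : 0 <= h z by exact: mule_ge0.
rewrite -[LHS](ge0_integral_distribution RV_pair mh)//.
rewrite independent_joint_law fubini_tonelli1// /fubini_F /h /=.
under eq_integral do rewrite ge0_integralZl//.
rewrite ge0_integralZr//; last exact: integral_ge0.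
by rewrite !ge0_integral_distribution.
Qed.

Section Real.
Variables f g : R -> R.
Hypotheses (mf : measurable_fun setT f) (mg : measurable_fun setT g).
Hypotheses (intf : P.-integrable setT (EFin \o (f \o X)))
           (intg : P.-integrable setT (EFin \o (g \o Y))).

Lemma independent_integrableM :
  P.-integrable setT (EFin \o (fun w => f (X w) * g (Y w))%R).
Proof.
apply/integrableP; split.
  by apply/measurable_EFinP; apply: measurable_funM; apply: measurableT_comp.
under eq_integral do rewrite /= normrM EFinM.
rewrite (@ge0_independent_integralM (fun x => `|f x|%:E) (fun y => `|g y|%:E))//;
  try by apply/measurable_EFinP; apply: measurableT_comp.
have [/integrableP[_ fX_fin] /integrableP[_ gY_fin]] := (intf, intg).
have fX_ge0 : 0 <= \int[P]_w `|f (X w)|%:E by exact: integral_ge0.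
by apply: lte_mul_pinfty => //; rewrite ge0_fin_numE.
Qed.

(** Fubini on the product of the two laws. Integrability on that product is
    read off from [independent_integrableM] through the joint law. *)
Lemma independent_expectationM :
  'E_P[(fun w => f (X w) * g (Y w))%R] = 'E_P[f \o X] * 'E_P[g \o Y].
Proof.
pose h (z : R * R) := (f z.1 * g z.2)%:E.
have mh : measurable_fun setT h.
  by apply/measurable_EFinP; apply: measurable_funM; apply: measurableT_comp.
have inth : P.-integrable setT (h \o RV_pair) by exact: independent_integrableM.
have inth2 : (distribution P X \x distribution P Y).-integrable setT h.
  apply/integrableP; split=> //; rewrite -independent_joint_law.
  rewrite ge0_integral_distribution//; last exact: measurableT_comp.
  by have /integrableP[] := inth.
rewrite unlock -[LHS](integral_distribution (X := RV_pair) mh inth).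
rewrite independent_joint_law.
rewrite -integral12_prod_meas1// /fubini_F /h /=.
have intgY : (distribution P Y).-integrable setT (EFin \o g).
  by apply: integrable_pushforward => //; exact/measurable_EFinP.
have intfX : (distribution P X).-integrable setT (EFin \o f).
  by apply: integrable_pushforward => //; exact/measurable_EFinP.
have EY : \int[distribution P Y]_y (g y)%:E = \int[P]_w (g (Y w))%:E.
  by rewrite integral_distribution//; exact/measurable_EFinP.
have EX : \int[distribution P X]_x (f x)%:E = \int[P]_w (f (X w))%:E.
  by rewrite integral_distribution//; exact/measurable_EFinP.
under eq_integral do under eq_integral do rewrite EFinM.
under eq_integral do rewrite integralZl// EY.
by rewrite -(fineK (integrable_fin_num _ intg))// integralZr// EX.
Qed.

End Real.
End Independence.

Section MomentCumulant.
Context {d : measure_display} {T : measurableType d} {R : realType}.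
Context {P : probability T R}.

Lemma moment_add_independent (X Y : {RV P >-> R}) k :
  finite_moments P X -> finite_moments P Y -> independent_RV P X Y ->
  moment P (X \+ Y) k =
    \sum_(i < k.+1) 'C(k, i)%:R * (moment P X i * moment P Y (k - i)).
Proof.
move=> hX hY indXY.
have mX n : measurable_fun setT (fun x : R => x ^+ n) by exact: exprn_measurable.
have intM i j : P.-integrable setT (EFin \o (fun w => X w ^+ i * Y w ^+ j)).
  exact: (independent_integrableM _ _ indXY _ _ (mX i) (mX j) (hX i) (hY j)).
have fin_moment Z n : finite_moments P Z ->
    'E_P[(fun w => Z w ^+ n)%R]%E \is a fin_num.
  by move=> hZ; rewrite unlock; exact: (integrable_fin_num measurableT (hZ n)).
rewrite {1}/moment unlock.
under eq_integral => w _.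
  (* [exprDn] puts the exponent [k - i] on its first summand, here [Y]. *)
  rewrite /= addrC exprDn -sumEFin.
  under eq_bigr => i _ do rewrite mulrC -mulr_natl EFinM.
  over.
have intCM i : P.-integrable setT
    (fun w => ('C(k, i)%:R)%:E * (X w ^+ i * Y w ^+ (k - i))%:E)%E.
  by apply: integrableZl => //; exact: intM.
rewrite integral_sum// -sum_fine => [|i _]; last exact: integrable_fin_num.
apply: eq_bigr => i _; rewrite (integralZl _ (intM i (k - i)%N))//.
have := independent_expectationM _ _ indXY _ _
  (mX i) (mX (k - i)%N) (hX i) (hY (k - i)%N).
rewrite {1}unlock => ->.
by rewrite !fineM ?fin_numM ?fin_moment.
Qed.

Lemma cumulant_transformE (X : T -> R) n :
  cumulant_transform P X n =
  'i%C ^+ n * real_complex R (fps_log (exp_moment_series P X) n).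
Proof. by rewrite /cumulant_transform fps_log_dilate fps_log_map. Qed.

End MomentCumulant.

Theorem theorem3p1 (d : measure_display) (T : measurableType d) (R : realType)
    (P : probability T R) (X Y : {RV P >-> R})
    (hX : finite_moments P X) (hY : finite_moments P Y) :
  [/\ independent_RV P X Y ->
        moment_series P (X \+ Y) =
        tconv (-1) (moment_series P X) (moment_series P Y),
      fps_dilate 'i%C (fps_toC (tcumulant_transform (-1) (moment_series P X))) =
        fps_mul (fpsX _) (fps_deriv (cumulant_transform P X))
    & forall n : nat, (1 <= n)%N ->
        n%:R * cumulant P X n =
        'i%C ^+ n * real_complex R (tcumulant (-1) (moment_series P X) n)].
Proof.
have coef n : n%:R * cumulant_transform P X n =
    'i%C ^+ n * real_complex R (tcumulant_transform (-1) (moment_series P X) n).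
  rewrite tcumulant_transformN1 cumulant_transformE.
  by rewrite (rmorphM (real_complex R)) rmorph_nat mulrCA.
split=> [indXY | | n _]; last exact: coef.
- by apply: funext => k; rewrite tconvN1; exact: moment_add_independent.
- by apply: funext => n; rewrite fps_mulX_deriv coef.
Qed.
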